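(* Let $p,q$ be positive integers, let $(\overline{M},\overline{g},J)$ be a metallic Riemannian manifold with $J^2=pJ+qI$, and let $M$ be an immersed submanifold of $\overline{M}$. Then $M$ is a hemi-slant submanifold of $\overline{M}$ if and only if there exists a constant $\lambda\in[0,1]$ such that $$D=\{X\in\Gamma(TM)\mid T^2X=\lambda(pTX+qX)\}$$ is a distribution and $TY=0$ for any $Y\in\Gamma(TM)$ orthogonal to $D$.
   Context: A metallic Riemannian manifold $(\overline{M},\overline{g},J)$ is a Riemannian manifold $(\overline{M},\overline{g})$ with a $(1,1)$-tensor field $J$ such that $J^2=pJ+qI$ for some positive integers $p,q$ ($I$ the identity) and $\overline{g}(JX,Y)=\overline{g}(X,JY)$ for all vector fields $X,Y$. $M$ is an isometrically immersed submanifold of $\overline{M}$, $\dim M<\dim\overline{M}$, with normal bundle $T^{\perp}M$. For $X\in\Gamma(TM)$ write $JX=TX+NX$ with $TX$ tangent and $NX$ normal to $M$. A differentiable distribution $D$ on $M$ is slant if the angle $\theta_D$ between $JX_x$ and the vector subspace $D_x$ is constant, for all $x\in M$ and all nonzero $X_x\in D_x$; $\theta_D$ is the slant angle. $M$ is a hemi-slant submanifold if there exist two orthogonal distributions $D^{\theta}$ and $D^{\perp}$ on $M$ such that: (1) $TM=D^{\theta}\oplus D^{\perp}$ (orthogonal direct sum); (2) $D^{\theta}$ is slant with angle $\theta\in[0,\frac{\pi}{2}]$; (3) $D^{\perp}$ is anti-invariant, i.e. $J(D^{\perp})\subseteq T^{\perp}M$. *)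

(* Defs.v *)
From mathcomp Require Import all_boot all_order all_algebra.
From mathcomp Require Import all_classical all_reals all_analysis.
Set Implicit Arguments.
Unset Strict Implicit.
Unset Printing Implicit Defensive.
Import Order.TTheory GRing.Theory Num.Theory.
Import numFieldNormedType.Exports.
Local Open Scope classical_set_scope.
Local Open Scope ring_scope.

(* [Ck k U f] is only used for open [U]; there it is the usual class C^k.     *)
Fixpoint Ck (R : realType) (V W : normedModType R) (k : nat)
    (U : set V) (f : V -> W) : Prop :=
  match k with
  | 0 => forall x, U x -> {for x, continuous f}
  | k'.+1 => (forall x, U x -> differentiable f x)
             /\ forall v : V, Ck k' U ('D_v f)
  end.

Definition smooth_on (R : realType) (V W : normedModType R)
  (U : set V) (f : V -> W) : Prop := forall k, Ck k U f.

(* Values of [chart_fun] outside [chart_dom], and of [chart_inv] outside the  *)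
(* image of [chart_dom], are irrelevant.                                      *)
Record chart (R : realType) (M : topologicalType) (n : nat) := Chart {
  chart_dom : set M;
  chart_fun : M -> 'rV[R]_n;
  chart_inv : 'rV[R]_n -> M;
  chart_dom_open : open chart_dom;
  chart_img_open : open (chart_fun @` chart_dom);
  chart_funK : forall x, chart_dom x -> chart_inv (chart_fun x) = x;
  chart_fun_cont : forall x, chart_dom x -> {for x, continuous chart_fun};
  chart_inv_cont : forall u, (chart_fun @` chart_dom) u ->
    {for u, continuous chart_inv} }.

(* A smooth n-manifold. The smooth structure is the one generated by an atlas *)
(* indexed by the points of M, [chart_at x] being a chart around x; every     *)
(* smooth structure has such an atlas.                                        *)
Record manifold (R : realType) (n : nat) := Manifold {
  carrier :> topologicalType;
  manifold_hausdorff : hausdorff_space carrier;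
  manifold_second_countable : @second_countable carrier;
  chart_at : carrier -> chart R carrier n;
  chart_at_dom : forall x, chart_dom (chart_at x) x;
  chart_at_smooth : forall x y,
    smooth_on (chart_fun (chart_at x)
                 @` (chart_dom (chart_at x) `&` chart_dom (chart_at y)))
              (chart_fun (chart_at y) \o chart_inv (chart_at x)) }.

(* Throughout, the tangent space T_x M is represented by 'rV[R]_n, a vector   *)
(* being given by its components in the chart [chart_at x]. The components of *)
(* a field [X : M -> 'rV_n] therefore refer to a chart that varies with the   *)
(* point; smoothness is always tested after passing to a fixed chart.         *)

(* The components in the chart [chart_at c] of a vector v of T_x M.           *)
Definition components (R : realType) (n : nat) (M : manifold R n) (c x : M)
  (v : 'rV[R]_n) : 'rV[R]_n :=
  'd (chart_fun (chart_at c) \o chart_inv (chart_at x))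
     (chart_fun (chart_at x) x) v.

(* The i-th coordinate vector of the chart [chart_at c], as element of T_x M. *)
Definition coord_field (R : realType) (n : nat) (M : manifold R n) (c : M)
  (i : 'I_n) (x : M) : 'rV[R]_n :=
  'd (chart_fun (chart_at x) \o chart_inv (chart_at c))
     (chart_fun (chart_at c) x) (delta_mx 0 i).

Definition smooth_fun (R : realType) (n : nat) (M : manifold R n)
  (U : set M) (h : M -> R) : Prop :=
  forall c : M, smooth_on (chart_fun (chart_at c) @` (U `&` chart_dom (chart_at c)))
                          (h \o chart_inv (chart_at c)).

Definition smooth_field (R : realType) (n : nat) (M : manifold R n)
  (U : set M) (X : M -> 'rV[R]_n) : Prop :=
  forall c : M, smooth_on (chart_fun (chart_at c) @` (U `&` chart_dom (chart_at c)))
    ((fun x => components c x (X x)) \o chart_inv (chart_at c)).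

Definition vector_field (R : realType) (n : nat) (M : manifold R n)
  (X : M -> 'rV[R]_n) : Prop := smooth_field [set: M] X.

Record metric (R : realType) (n : nat) (M : manifold R n) := Metric {
  inner :> forall x : M, 'rV[R]_n -> 'rV[R]_n -> R;
  inner_linear : forall (x : M) (a : R) (u v w : 'rV[R]_n),
    inner x (a *: u + v) w = a * inner x u w + inner x v w;
  inner_sym : forall (x : M) (u v : 'rV[R]_n), inner x u v = inner x v u;
  inner_pos : forall (x : M) (u : 'rV[R]_n), u != 0 -> 0 < inner x u u;
  inner_smooth : forall (c : M) (i j : 'I_n),
    smooth_fun (chart_dom (chart_at c))
      (fun x => inner x (coord_field c i x) (coord_field c j x)) }.

(* Smooth (1,1)-tensor fields. *)
Record tensor11 (R : realType) (n : nat) (M : manifold R n) := Tensor11 {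
  tensor :> forall x : M, {linear 'rV[R]_n -> 'rV[R]_n};
  tensor_smooth : forall (c : M) (i : 'I_n),
    smooth_field (chart_dom (chart_at c))
      (fun x => tensor x (coord_field c i x)) }.

Definition metallic (R : realType) (n : nat) (M : manifold R n)
  (g : metric M) (p q : nat) (J : tensor11 M) : Prop :=
  (forall (x : M) (v : 'rV[R]_n), J x (J x v) = p%:R *: J x v + q%:R *: v) /\
  (forall (x : M) (u v : 'rV[R]_n), g x (J x u) v = g x u (J x v)).

Definition smooth_map (R : realType) (m n : nat) (M : manifold R m)
  (N : manifold R n) (f : M -> N) : Prop :=
  continuous f /\
  forall (x : M) (y : N),
    smooth_on (chart_fun (chart_at x)
                 @` (chart_dom (chart_at x) `&` f @^-1` chart_dom (chart_at y)))
              (chart_fun (chart_at y) \o f \o chart_inv (chart_at x)).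

(* The differential T_x M -> T_(f x) N. *)
Definition differential (R : realType) (m n : nat) (M : manifold R m)
  (N : manifold R n) (f : M -> N) (x : M) (v : 'rV[R]_m) : 'rV[R]_n :=
  'd (chart_fun (chart_at (f x)) \o f \o chart_inv (chart_at x))
     (chart_fun (chart_at x) x) v.

Definition isometric_immersion (R : realType) (m n : nat) (M : manifold R m)
  (N : manifold R n) (g : metric M) (gN : metric N) (f : M -> N) : Prop :=
  [/\ smooth_map f,
      forall x : M, injective (differential f x) &
      forall (x : M) (u v : 'rV[R]_m),
        gN (f x) (differential f x u) (differential f x v) = g x u v].

(* The unique tangent vector w = T v of the decomposition J v = T v + N v     *)
(* (T_x M being identified with its image under the differential of f).       *)
Definition tan_part (R : realType) (m n : nat) (M : manifold R m)
  (N : manifold R n) (gN : metric N) (J : tensor11 N) (f : M -> N)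
  (x : M) (v : 'rV[R]_m) : 'rV[R]_m :=
  xget 0 [set w | forall u : 'rV[R]_m,
    gN (f x) (J (f x) (differential f x v) - differential f x w)
             (differential f x u) = 0].

Definition orth_proj (R : realType) (n : nat)
  (b : 'rV[R]_n -> 'rV[R]_n -> R) (S : set 'rV[R]_n) (w : 'rV[R]_n) :
  'rV[R]_n :=
  xget 0 [set s | S s /\ forall t, S t -> b (w - s) t = 0].

(* The angle in [0, pi/2] between a nonzero vector w and a subspace S, for    *)
(* the inner product b: the angle between w and its orthogonal projection on  *)
(* S, and pi/2 when the projection vanishes.                                  *)
Definition angle (R : realType) (n : nat)
  (b : 'rV[R]_n -> 'rV[R]_n -> R) (w : 'rV[R]_n) (S : set 'rV[R]_n) : R :=
  let s := orth_proj b S w in acos (Num.sqrt (b s s) / Num.sqrt (b w w)).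

(* Smooth distributions of constant rank (possibly 0). *)
Definition smooth_distribution (R : realType) (m : nat) (M : manifold R m)
  (D : M -> {vspace 'rV[R]_m}) : Prop :=
  exists k : nat, forall x : M, exists U : set M, exists X : 'I_k -> M -> 'rV[R]_m,
    [/\ open U, U x,
        forall i, smooth_field U (X i) &
        forall y, U y -> basis_of (D y) [tuple X i y | i < k]].

Definition sections (R : realType) (m : nat) (M : manifold R m)
  (D : M -> {vspace 'rV[R]_m}) : set (M -> 'rV[R]_m) :=
  [set X | vector_field X /\ forall x, X x \in D x].

Definition slant (R : realType) (m n : nat) (M : manifold R m)
  (N : manifold R n) (gN : metric N) (J : tensor11 N) (f : M -> N)
  (D : M -> {vspace 'rV[R]_m}) (theta : R) : Prop :=
  forall (x : M) (v : 'rV[R]_m), v \in D x -> v != 0 ->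
    angle (gN (f x)) (J (f x) (differential f x v))
          (differential f x @` [set` D x]) = theta.

Definition anti_invariant (R : realType) (m n : nat) (M : manifold R m)
  (N : manifold R n) (gN : metric N) (J : tensor11 N) (f : M -> N)
  (D : M -> {vspace 'rV[R]_m}) : Prop :=
  forall (x : M) (v u : 'rV[R]_m), v \in D x ->
    gN (f x) (J (f x) (differential f x v)) (differential f x u) = 0.

Definition hemi_slant (R : realType) (m n : nat) (M : manifold R m)
  (N : manifold R n) (g : metric M) (gN : metric N) (J : tensor11 N)
  (f : M -> N) : Prop :=
  exists Dth Dperp : M -> {vspace 'rV[R]_m},
    [/\ smooth_distribution Dth /\ smooth_distribution Dperp,
        forall (x : M) (u v : 'rV[R]_m),
          u \in Dth x -> v \in Dperp x -> g x u v = 0,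
        forall x : M, (Dth x + Dperp x)%VS = fullv,
        exists2 theta : R, 0 <= theta <= pi / 2 & slant gN J f Dth theta &
        anti_invariant gN J f Dperp].

(* Main.v *)
Require Import Defs.
From mathcomp Require Import all_boot all_order all_algebra.
From mathcomp Require Import all_classical all_reals all_analysis.
From mathcomp Require Import ring lra.
Set Implicit Arguments.
Unset Strict Implicit.
Unset Printing Implicit Defensive.
Import Order.TTheory GRing.Theory Num.Theory.
Import numFieldNormedType.Exports.
Local Open Scope classical_set_scope.
Local Open Scope ring_scope.

(* Pointwise, T is self-adjoint for g and |J X|^2 = p g(T X, X) + q g(X, X). If
   T maps D into itself, the projection of J X on D is T X, so D is slant of angle
   theta iff |T X|^2 = cos^2 theta |J X|^2 on D, which by polarization reads
   T^2 = cos^2 theta (p T + q) on D; and T maps D into itself as soon as T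
   vanishes on the orthogonal complement of D. To pass between vectors and global
   fields, every vector of a smooth distribution is extended to a global section
   by a bump function, built from exp (-1/t) in a chart and supported in a compact
   set, which is closed because M is Hausdorff; and the orthogonal complement of a
   smooth distribution is shown to be smooth. *)

(** * Functions of class C^k *)

(** The difference [g - f] is zero near [x], so its little-o expansion holds with zero differential;
    then [g = f + (g - f)]. *)
Lemma near_eq_differentiable (R : realType) (V W : normedModType R)
    (f g : V -> W) (x : V) :
  (\forall y \near x, f y = g y) -> differentiable f x -> differentiable g x.
Proof.
move=> fg df; have e0 : \forall y \near x, (g - f) y = 0.
  by near do rewrite !fctE (near fg) ?subrr //.
suff de : differentiable (g - f) x.
  have -> : g = f + (g - f) by rewrite addrC subrK.
  exact: differentiableD.
have eq0 : (g - f) \o shift x = cst ((g - f) x) + \0 +o_ 0 id.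
  apply/eqaddoP => _/posnumP[e]; rewrite (nbhs_singleton e0).
  move: e0; rewrite (near_shift 0) subr0.
  apply: filterS => h; rewrite !fctE /= => ->.
  by rewrite !addr0 subr0 normr0 mulr_ge0.
apply/diff_locallyP; rewrite (@diff_unique _ _ _ _ \0) //.
have c0 : continuous (\0 : V -> W) by move=> y; exact: cst_continuous.
  by split.
by move=> y; exact: cst_continuous.
Unshelve. all: by end_near. Qed.

(** [Ck] only tests points of [U], while derivatives are taken in the whole space. Smoothness can
    thus be checked point by point and restricted to arbitrary subsets. *)
Lemma Ck_set1 (R : realType) (V W : normedModType R) k (U : set V) (f : V -> W) :
  Ck k U f <-> forall x, U x -> Ck k [set x] f.
Proof.
elim: k f => [|k IH] f; first by split=> [fU x Ux _ ->|fU x /fU]; [exact: fU|exact].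
split=> [[df fU] x Ux|fU].
  by split=> [_ ->|v]; [exact: df|exact: (IH _).1 (fU v) x Ux].
split=> [x Ux|v]; first exact: (fU x Ux).1.
by apply/IH => x /fU[_]; exact.
Qed.

Lemma Ck_sub (R : realType) (V W : normedModType R) k (A B : set V) (f : V -> W) :
  A `<=` B -> Ck k B f -> Ck k A f.
Proof. by move=> AB /Ck_set1 fB; apply/Ck_set1 => x /AB; exact: fB. Qed.

Lemma CkS_Ck (R : realType) (V W : normedModType R) k (U : set V) (f : V -> W) :
  Ck k.+1 U f -> Ck k U f.
Proof.
elim: k f => [|k IH] f [df fU]; first by move=> x /df/differentiable_continuous.
by split=> // v; apply: IH.
Qed.

(** Openness turns equality on [U] into equality near each point, which is what limits and
    derivatives see. *)
Lemma eq_Ck (R : realType) (V W : normedModType R) k (U : set V) (f g : V -> W) :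
  open U -> (forall x, U x -> f x = g x) -> Ck k U f -> Ck k U g.
Proof.
move=> oU; have nU x : U x -> \forall y \near x, U y.
  by move=> Ux; apply: open_nbhs_nbhs.
elim: k f g => [|k IH] f g fg.
  move=> cf x Ux; rewrite /prop_for /continuous_at -(fg x Ux).
  have : f y @[y --> x] --> f x by exact: cf.
  apply: cvg_trans; apply: near_eq_cvg.
  by near=> y; apply: fg; near: y; exact: nU.
move=> [df fU]; split=> [x Ux|v].
  apply: near_eq_differentiable (df x Ux).
  by near=> y; apply: fg; near: y; exact: nU.
apply: IH (fU v) => x Ux; apply: near_eq_derive.
by near=> y; apply: fg; near: y; exact: nU.
Unshelve. all: by end_near. Qed.

Lemma Ck_cst (R : realType) (V W : normedModType R) k (U : set V) (a : W) :
  Ck k U (cst a : V -> W).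
Proof.
elim: k a => [|k IH] a; first by move=> x _; exact: cst_continuous.
split=> [x _|v]; first exact: differentiable_cst.
by rewrite (_ : 'D_v _ = cst 0)//; apply/funext => x; rewrite derive_cst.
Qed.

Lemma Ck_add (R : realType) (V W : normedModType R) k (U : set V) (f g : V -> W) :
  open U -> Ck k U f -> Ck k U g -> Ck k U (f + g).
Proof.
move=> oU; elim: k f g => [|k IH] f g.
  by move=> cf cg x Ux; apply: cvgD; [exact: cf|exact: cg].
move=> [df fU] [dg gU]; split=> [x Ux|v].
  by apply: differentiableD; [exact: df|exact: dg].
apply: (eq_Ck oU _ (IH _ _ (fU v) (gU v))) => x Ux.
by rewrite deriveD//; apply: diff_derivable; [exact: df|exact: dg].
Qed.

Lemma Ck_sum (R : realType) (V W : normedModType R) k (U : set V)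
    (I : Type) (r : seq I) (P : pred I) (f : I -> V -> W) :
  open U -> (forall i, Ck k U (f i)) -> Ck k U (\sum_(i <- r | P i) f i).
Proof.
move=> oU fU; elim/big_ind: _ => //; [exact: Ck_cst|].
by move=> g h; exact: Ck_add.
Qed.

Lemma Ck_mul (R : realType) (V : normedModType R) k (U : set V) (f g : V -> R) :
  open U -> Ck k U f -> Ck k U g -> Ck k U (f * g).
Proof.
move=> oU; elim: k f g => [|k IH] f g.
  by move=> cf cg x Ux; apply: cvgM; [exact: cf|exact: cg].
move=> Cf Cg; have [df fU] := Cf; have [dg gU] := Cg; split=> [x Ux|v].
  by apply: differentiableM; [exact: df|exact: dg].
apply: (@eq_Ck _ _ _ _ _ (f * 'D_v g + g * 'D_v f)) => //.
  move=> x Ux; rewrite deriveM//; apply: diff_derivable; [exact: df|exact: dg].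
apply: Ck_add => //; apply: IH; first [exact: CkS_Ck|exact: fU|exact: gU].
Qed.

Lemma Ck_mxP (R : realType) (V : normedModType R) k (U : set V) n
    (f : V -> 'rV[R]_n) : open U ->
  Ck k U f <-> forall i, Ck k U (fun x => f x 0 i).
Proof.
move=> oU; split=> [+ i|].
  elim: k f => [|k IH] f.
    move=> cf x Ux; apply: (@continuous_comp _ _ _ f (fun v : 'rV_n => v 0 i)).
      exact: cf.
    exact: coord_continuous.
  move=> [df fU]; split=> [x Ux|v].
    apply: (@differentiable_comp _ _ _ _ f (fun v : 'rV_n => v 0 i)).
      exact: df.
    exact: differentiable_coord.
  apply: (eq_Ck oU _ (IH _ (fU v))) => x Ux.
  by rewrite derive_mx ?mxE//; apply: diff_derivable; exact: df.
(* For the converse, [f] is written as a sum of scalar functions times constant basis vectors. *)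
have fE : f = \sum_(i < n) (fun x => f x 0 i *: (delta_mx 0 i : 'rV[R]_n)).
  apply/funext => x; rewrite fct_sumE {1}[f x]matrix_sum_delta.
  by rewrite big_ord1.
elim: k f fE => [|k IH] f fE cf.
  move=> x Ux; rewrite fE; apply: (Ck_sum (k := 0)) oU _ _ Ux => i y Uy.
  by apply: cvgZr_tmp; exact: cf.
have df x : U x -> differentiable f x.
  move=> Ux; rewrite fE; apply: differentiable_sum => i.
  by apply: differentiableZl; exact: (cf i).1.
split=> // v; apply: IH => [|i].
  apply/funext => x; rewrite fct_sumE {1}['D_v f x]matrix_sum_delta.
  by rewrite big_ord1.
apply: (eq_Ck oU _ ((cf i).2 v)) => x Ux.
by rewrite derive_mx ?mxE//; apply: diff_derivable; exact: df.
Qed.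

(** Induction on [k]: by the chain rule the derivative along [v] is a sum of products of coordinates
    of ['D_v f] with partial derivatives of [g] composed with [f], all of one class lower. *)
Lemma Ck_comp (R : realType) (V : normedModType R) k n (U : set V) (A : set 'rV[R]_n)
    (f : V -> 'rV[R]_n) (g : 'rV[R]_n -> R) :
  open U -> (forall x, U x -> A (f x)) ->
  Ck k U f -> Ck k A g -> Ck k U (g \o f).
Proof.
move=> oU fA; elim: k g => [|k IH] g.
  by move=> cf cg x Ux; apply: continuous_comp; [exact: cf|exact/cg/fA].
move=> Cf [dg gA]; have [df fU] := Cf; split=> [x Ux|v].
  by apply: differentiable_comp; [exact: df|exact/dg/fA].
apply: (@eq_Ck _ _ _ _ _
    (\sum_(i < n) (fun x => 'D_v f x 0 i) * ('D_(delta_mx 0 i) g \o f))) => //.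
  move=> x Ux; rewrite deriveE; last first.
    by apply: differentiable_comp; [exact: df|exact/dg/fA].
  rewrite diff_comp; [|exact: df|exact/dg/fA].
  rewrite [RHS]/= -(deriveE v (df x Ux)).
  rewrite [in RHS](matrix_sum_delta ('D_v f x)) big_ord1 linear_sum fct_sumE.
  apply: eq_bigr => i _; by rewrite linearZ /= -(deriveE _ (dg _ (fA _ Ux))).
apply: Ck_sum => // i; apply: Ck_mul => //.
  by have /Ck_mxP := fU v; apply.
by apply: IH; [exact: CkS_Ck|exact: gA].
Qed.

(** * A flat function *)

(** The chain rule only shifts the index [j], so the induction on [k] is run for all members of the
    sequence [H] at once. *)
Lemma Ck_comp_derivatives (R : realType) (V : normedModType R) (H : nat -> R -> R)
    k j (U : set V) (s : V -> R) :
  (forall j (t : R), is_derive t (1 : R) (H j) (H j.+1 t)) ->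
  open U -> Ck k U s -> Ck k U (H j \o s).
Proof.
move=> dH oU; elim: k j => [|k IH] j.
  move=> cs x Ux; apply: continuous_comp; first exact: cs.
  exact/differentiable_continuous/derivable1_diffP.
move=> Cs; have [ds sU] := Cs; have dHj t : differentiable (H j) t.
  exact/derivable1_diffP.
split=> [x Ux|v]; first by apply: differentiable_comp; [exact: ds|].
apply: (@eq_Ck _ _ _ _ _ ('D_v s * (H j.+1 \o s))) => //.
  move=> x Ux; rewrite deriveE; last by apply: differentiable_comp; [exact: ds|].
  rewrite diff_comp; [|exact: ds|by []].
  rewrite [RHS]/= -(deriveE v (ds x Ux)) deriv1E; last exact/derivable1_diffP.
  by rewrite derive1E derive_val.
by apply: Ck_mul; [|exact: sU|apply: IH; exact: CkS_Ck].
Qed.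

(* The factor p makes the family of these functions closed under
   differentiation; flat_exp 1 is the usual exp (-1/t). *)
Definition flat_exp (R : realType) (p : {poly R}) (t : R) : R :=
  if 0 < t then p.[t^-1] * expR (- t^-1) else 0.

Lemma flat_exp_le (R : realType) (p : {poly R}) :
  exists2 C : R, 0 < C & forall t, `|t| <= 1 -> `|flat_exp p t| <= C * t ^+ 2.
Proof.
pose n := size p; pose S : R := \sum_(i < n) `|p`_i|.
have S0 : 0 <= S by apply: sumr_ge0.
have F0 : 0 < (n.+2)`!%:R :> R by rewrite ltr0n fact_gt0.
(* Adding 1 to [S] keeps the constant positive even for [p = 0]. *)
exists ((S + 1) * (n.+2)`!%:R); first by rewrite mulr_gt0// ltr_wpDl.
move=> t t1; rewrite /flat_exp; case: ifPn => [t0|_]; last first.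
  by rewrite normr0 mulr_ge0 ?sqr_ge0// mulr_ge0 ?(ltW F0)// addr_ge0.
have x1 : 1 <= t^-1 by rewrite invf_ge1// -(gtr0_norm t0).
move: (t^-1) (x1) (invrK t) => x {}x1 xt; rewrite -{t t1}xt in t0 *.
have x0 : 0 < x by exact: lt_le_trans x1.
have px : `|p.[x]| <= (S + 1) * x ^+ n.
  rewrite horner_coef (le_trans (ler_norm_sum _ _ _))//.
  apply: (@le_trans _ _ (S * x ^+ n)); last first.
    by rewrite ler_wpM2r ?exprn_ge0 ?(ltW x0)// lerDl.
  rewrite /S mulr_suml; apply: ler_sum => i _.
  rewrite normrM ler_wpM2l// normrX gtr0_norm//.
  by rewrite ler_weXn2l// ltnW.
have ex : x ^+ n.+2 / (n.+2)`!%:R <= expR x.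
  by apply: le_trans (expR_ge1Dxn n.+1 (ltW x0)); rewrite lerDr.
rewrite normrM (gtr0_norm (expR_gt0 _)) expRN.
rewrite ler_pdivrMr ?expR_gt0// (le_trans px)//.
rewrite -!mulrA ler_wpM2l ?addr_ge0//.
apply: (@le_trans _ _ ((n.+2)`!%:R * (x^-1 * (x^-1 * (x ^+ n.+2 / (n.+2)`!%:R))))).
  rewrite !exprS le_eqVlt; apply/orP; left; apply/eqP.
  by field; rewrite !gt_eqF.
by rewrite ler_wpM2l ?(ltW F0)// ler_wpM2l ?(ltW t0)// ler_wpM2l ?(ltW t0).
Qed.

(** For [t > 0] the product rule gives [t ^- 2 * (p - p^]()).[t^-1] * expR (- t^-1)[. At 0 the
    difference quotient is at most]C * [|h|] by the quadratic bound. *)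
Lemma is_derive_flat_exp (R : realType) (p : {poly R}) (t : R) :
  is_derive t 1 (flat_exp p) (flat_exp ('X^2 * (p - p^`())) t).
Proof.
have [t0|t0|->] := ltgtP t 0.
- have -> : flat_exp ('X^2 * (p - p^`())) t = 0 by rewrite /flat_exp ltNge ltW.
  apply: (@near_eq_is_derive _ R R (cst 0)).
  near=> y; rewrite /flat_exp ifF//; apply/negbTE; rewrite -leNgt ltW//.
  by near: y; exact: lt_nbhsl.
- have tn0 : t != 0 by rewrite gt_eqF.
  apply: (@near_eq_is_derive _ R R (fun y => p.[y^-1] * expR (- y^-1))).
    by near=> y; rewrite /flat_exp ifT//; near: y; exact: lt_nbhsr.
  have dinv : is_derive t 1 (fun y : R => y^-1) (- t ^- 2).
    apply: DeriveDef; first exact: derivableV.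
    by rewrite deriveV// derive_id /GRing.scale /= mulr1.
  have dp : is_derive t 1 (fun y : R => p.[y^-1]) (- t ^- 2 * p^`().[t^-1]).
    rewrite mulrC; apply: (@is_derive1_comp _ (horner p) (fun y => y^-1)).
  have de : is_derive t 1 (fun y : R => expR (- y^-1)) (t ^- 2 * expR (- t^-1)).
    have dN : is_derive t 1 (fun y : R => - y^-1) (t ^- 2).
      by apply: is_derive_eq; rewrite opprK.
    rewrite mulrC; apply: (@is_derive1_comp _ expR (fun y => - y^-1)).
  apply: is_derive_eq; rewrite /flat_exp t0 !hornerE /GRing.scale /=.
  rewrite exprVn; ring.
- have -> : flat_exp ('X^2 * (p - p^`())) 0 = 0 by rewrite /flat_exp ltxx.
  have [C C0 pC] := flat_exp_le p.
  suff c : h^-1 *: (flat_exp p (h *: 1 + 0) - flat_exp p 0) @[h --> (0:R)^'] --> (0 : R).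
    apply: DeriveDef; first by apply/cvg_ex; exists 0.
    exact: cvg_lim c.
  apply/cvgrPdist_le => e e0; near=> h.
  have h0 : h != 0 by near: h; exact: nbhs_dnbhs_neq.
  rewrite {2}/flat_exp ltxx addr0 subr0 sub0r normrN scaler1 normrZ normfV.
  rewrite ler_pdivrMl ?normr_gt0// (le_trans (pC _ _))//.
    by near: h; exact: dnbhs0_le.
  rewrite -real_normK ?num_real// expr2 mulrA [leRHS]mulrC ler_wpM2r//.
  rewrite -ler_pdivlMl//; near: h; apply: dnbhs0_le.
  by rewrite mulr_gt0 ?invr_gt0.
Unshelve. all: by end_near. Qed.

(** Iterating [D] from the polynomial 1 lists the successive derivatives of [flat_exp 1]. *)
Lemma Ck_flat_exp (R : realType) (V : normedModType R) k (U : set V) (s : V -> R) :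
  open U -> Ck k U s -> Ck k U (flat_exp 1 \o s).
Proof.
move=> oU; pose D p : {poly R} := 'X^2 * (p - p^`()).
apply: (@Ck_comp_derivatives _ _ (fun j => flat_exp (iter j D 1)) k 0%N) => // j t.
exact: is_derive_flat_exp.
Qed.

(** * Smooth functions and fields on a manifold *)

Lemma diff_comp_derive (R : realType) (U V W : normedModType R) (f : U -> V)
    (g : V -> W) x y v : f x = y -> differentiable f x -> differentiable g y ->
  'd g y ('d f x v) = 'D_v (g \o f) x.
Proof.
move=> <- df dg; rewrite deriveE; last exact: differentiable_comp.
exact: esym (congr1 (@^~ v) (diff_comp df dg)).
Qed.

Section Charts.
Context (R : realType) (n : nat) (M : manifold R n).
Implicit Types (U V : set M) (c x y : M) (h : M -> R) (X Y : M -> 'rV[R]_n).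

Local Notation dom c := (chart_dom (chart_at c)).
Local Notation phi c := (chart_fun (chart_at c)).
Local Notation psi c := (chart_inv (chart_at c)).

(** The image is the part of the chart image that the continuous [psi c] sends into [U]. *)
Lemma open_chart_image c U : open U -> open (phi c @` (U `&` dom c)).
Proof.
move=> oU.
have -> : phi c @` (U `&` dom c) = phi c @` dom c `&` psi c @^-1` U.
  apply/seteqP; split=> [_ [y [Uy cy] <-]|_ [[y cy <-]]].
    by split; [exists y|rewrite /preimage /= chart_funK].
  by rewrite /preimage /= chart_funK// => Uy; exists y.
rewrite openE => u [cu Uu]; apply: filterI.
  by apply: open_nbhs_nbhs; split=> //; exact: chart_img_open.
by apply: (chart_inv_cont cu); exact: open_nbhs_nbhs.
Qed.

Lemma chart_image_sub c U V : U `<=` V ->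
  phi c @` (U `&` dom c) `<=` phi c @` (V `&` dom c).
Proof. by move=> UV u [y [/UV Vy cy] <-]; exists y. Qed.

Lemma transition_differentiable a b x : dom a x -> dom b x ->
  differentiable (phi b \o psi a) (phi a x).
Proof.
move=> ax bx; apply: (@chart_at_smooth _ _ M a b 1%N).1.
by exists x.
Qed.

Lemma near_chart a x U : open U -> U x -> dom a x ->
  \forall u \near phi a x, (phi a @` (U `&` dom a)) u.
Proof.
move=> oU Ux ax; apply: open_nbhs_nbhs; split; first exact: open_chart_image.
by exists x.
Qed.

(** The cocycle rule for changes of chart: the chain rule applies, and [psi b] undoes [phi b] near
    the point. *)
Lemma derive_transition a b c x v : dom a x -> dom b x -> dom c x ->
  'd (phi c \o psi b) (phi b x) ('d (phi b \o psi a) (phi a x) v) =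
  'D_v (phi c \o psi a) (phi a x).
Proof.
move=> ax bx cx; rewrite diff_comp_derive.
- apply: near_eq_derive.
  have : \forall u \near phi a x, (phi a @` (dom b `&` dom a)) u.
    by apply: near_chart => //; exact: chart_dom_open.
  by apply: filterS => _ [y [yb ya] <-]; rewrite /comp !chart_funK.
- by rewrite /comp chart_funK.
- exact: transition_differentiable.
- exact: transition_differentiable.
Qed.

Lemma derive_transition_id a x v : dom a x ->
  'D_v (phi a \o psi a) (phi a x) = v.
Proof.
move=> ax; rewrite -[RHS](@derive_id _ _ (phi a x)); apply: near_eq_derive.
have : \forall u \near phi a x, (phi a @` (setT `&` dom a)) u.
  by apply: near_chart => //; exact: openT.
by apply: filterS => _ [y [_ ya] <-]; rewrite /comp !chart_funK.
Qed.

Lemma componentsD c x u v :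
  components c x (u + v) = components c x u + components c x v.
Proof. exact: linearD. Qed.

Lemma componentsZ c x a v : components c x (a *: v) = a *: components c x v.
Proof. exact: linearZ. Qed.

Lemma coord_field_expansion c x v : dom c x ->
  v = \sum_(i < n) components c x v 0 i *: coord_field c i x.
Proof.
move=> cx; have xx := @chart_at_dom _ _ M x.
(* By the cocycle rule, passing to the chart at [c] and back is the identity on the tangent
   space. *)
have vE : 'd (phi x \o psi c) (phi c x) (components c x v) = v.
  exact: etrans (derive_transition v xx cx xx) (derive_transition_id v xx).
rewrite -{1}vE; move: (components c x v) => {vE} w.
rewrite {1}(row_sum_delta w) linear_sum; apply: eq_bigr => i _.
exact: linearZ.
Qed.

Lemma components_coord_field c d i x : dom c x -> dom d x ->
  components d x (coord_field c i x) =
  'D_(delta_mx 0 i) (phi d \o psi c) (phi c x).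
Proof. by move=> cx dx; apply: derive_transition => //; exact: chart_at_dom. Qed.

Lemma smooth_fun_sub U V h : U `<=` V -> smooth_fun V h -> smooth_fun U h.
Proof. by move=> UV hV c k; apply: Ck_sub (hV c k); exact: chart_image_sub. Qed.

Lemma smooth_field_sub U V X : U `<=` V -> smooth_field V X -> smooth_field U X.
Proof. by move=> UV XV c k; apply: Ck_sub (XV c k); exact: chart_image_sub. Qed.

Lemma smooth_fun_local U h :
  (forall x, U x -> exists2 V : set M, V x & smooth_fun V h) -> smooth_fun U h.
Proof.
move=> hV c k; apply/Ck_set1 => u [x [/hV[V Vx hVs] cx] <-].
by apply: Ck_sub (hVs c k) => _ ->; exists x.
Qed.

Lemma smooth_field_local U X :
  (forall x, U x -> exists2 V : set M, V x & smooth_field V X) ->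
  smooth_field U X.
Proof.
move=> hV c k; apply/Ck_set1 => u [x [/hV[V Vx hVs] cx] <-].
by apply: Ck_sub (hVs c k) => _ ->; exists x.
Qed.

Lemma eq_smooth_fun U h h' : open U -> (forall x, U x -> h x = h' x) ->
  smooth_fun U h -> smooth_fun U h'.
Proof.
move=> oU hh' hU c k; apply: (eq_Ck _ _ (hU c k)); first exact: open_chart_image.
by move=> u [x [Ux cx] <-] /=; rewrite chart_funK ?hh'.
Qed.

Lemma eq_smooth_field U X Y : open U -> (forall x, U x -> X x = Y x) ->
  smooth_field U X -> smooth_field U Y.
Proof.
move=> oU hh' hU c k; apply: (eq_Ck _ _ (hU c k)); first exact: open_chart_image.
by move=> u [x [Ux cx] <-] /=; rewrite chart_funK ?hh'.
Qed.

Lemma smooth_fun_cst U a : smooth_fun U (cst a : M -> R).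
Proof. by move=> c k; exact: Ck_cst. Qed.

Lemma smooth_fun_add U h h' : open U ->
  smooth_fun U h -> smooth_fun U h' -> smooth_fun U (fun x => h x + h' x).
Proof.
move=> oU hU hU' c k.
by apply: Ck_add (hU c k) (hU' c k); exact: open_chart_image.
Qed.

Lemma smooth_fun_mul U h h' : open U ->
  smooth_fun U h -> smooth_fun U h' -> smooth_fun U (fun x => h x * h' x).
Proof.
move=> oU hU hU' c k.
by apply: Ck_mul (hU c k) (hU' c k); exact: open_chart_image.
Qed.

Lemma smooth_fun_sum U (I : Type) (r : seq I) (P : pred I) (h : I -> M -> R) :
  open U -> (forall i, smooth_fun U (h i)) ->
  smooth_fun U (fun x => \sum_(i <- r | P i) h i x).
Proof.
move=> oU hU; elim: r => [|i r IH].
  by under eq_fun do rewrite big_nil; exact: smooth_fun_cst.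
under eq_fun do rewrite big_cons; case: (P i) => //.
exact: smooth_fun_add.
Qed.

Lemma smooth_fun_prod U (I : Type) (r : seq I) (P : pred I) (h : I -> M -> R) :
  open U -> (forall i, smooth_fun U (h i)) ->
  smooth_fun U (fun x => \prod_(i <- r | P i) h i x).
Proof.
move=> oU hU; elim: r => [|i r IH].
  by under eq_fun do rewrite big_nil; exact: smooth_fun_cst.
under eq_fun do rewrite big_cons; case: (P i) => //.
exact: smooth_fun_mul.
Qed.

(** The Leibniz formula is a polynomial in the entries. *)
Lemma smooth_fun_det U k (A : M -> 'M[R]_k) : open U ->
  (forall i j, smooth_fun U (fun x => A x i j)) ->
  smooth_fun U (fun x => \det (A x)).
Proof.
move=> oU AU; apply: smooth_fun_sum => // s; apply: smooth_fun_mul => //.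
  exact: smooth_fun_cst.
exact: smooth_fun_prod.
Qed.

Lemma smooth_fun_adj U k (A : M -> 'M[R]_k) i j : open U ->
  (forall i j, smooth_fun U (fun x => A x i j)) ->
  smooth_fun U (fun x => \adj (A x) i j).
Proof.
move=> oU AU; under eq_fun do rewrite mxE.
apply: smooth_fun_mul => //; first exact: smooth_fun_cst.
apply: smooth_fun_det => // a b.
by under eq_fun do rewrite !mxE; exact: AU.
Qed.

(** Near [x], [h] is its chart expression after the chart map. This will make the locus where a
    determinant is nonzero open. *)
Lemma smooth_fun_continuous U h x : open U -> U x -> smooth_fun U h ->
  {for x, continuous h}.
Proof.
move=> oU Ux hU; have xx := @chart_at_dom _ _ M x.
have : {for x, continuous ((h \o psi x) \o phi x)}.
  apply: continuous_comp; first exact: chart_fun_cont.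
  by apply: (hU x 0%N); exists x.
rewrite /prop_for /continuous_at /= chart_funK//.
apply: cvg_trans; apply: near_eq_cvg.
have : \forall y \near x, dom x y.
  by apply: open_nbhs_nbhs; split=> //; exact: chart_dom_open.
by apply: filterS => y yx /=; rewrite chart_funK.
Qed.

(** Read in another chart [d], the pulled-back function is [h] after a transition map. *)
Lemma smooth_fun_chart U c (h : 'rV[R]_n -> R) : open U ->
  smooth_on (phi c @` (U `&` dom c)) h -> smooth_fun (U `&` dom c) (h \o phi c).
Proof.
move=> oU hU d k; have oUc : open (U `&` dom c).
  by apply: openI => //; exact: chart_dom_open.
apply: (@Ck_comp _ _ _ _ _ (phi c @` (U `&` dom c)) (phi c \o psi d) h) => //.
- exact: open_chart_image.
- by move=> u [x [[Ux cx] dx] <-] /=; rewrite chart_funK//; exists x.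
- apply: Ck_sub (@chart_at_smooth _ _ M d c k) => u [x [[Ux cx] dx] <-].
  by exists x.
Qed.

Lemma smooth_fieldP U X : open U ->
  smooth_field U X <->
  forall c i, smooth_on (phi c @` (U `&` dom c))
    ((fun x => components c x (X x) 0 i) \o psi c).
Proof.
move=> oU; split=> [XU c i k|XU c k].
  by have /Ck_mxP := XU c k; apply; exact: open_chart_image.
by apply/Ck_mxP => [|i]; [exact: open_chart_image|exact: XU].
Qed.

Lemma smooth_field_add U X Y : open U ->
  smooth_field U X -> smooth_field U Y -> smooth_field U (fun x => X x + Y x).
Proof.
move=> oU XU YU c k; have oc := open_chart_image (c := c) oU.
have -> : (fun x => components c x (X x + Y x)) \o psi c =
    ((fun x => components c x (X x)) \o psi c) +
    ((fun x => components c x (Y x)) \o psi c).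
  by apply/funext => u /=; rewrite componentsD.
exact: Ck_add (XU c k) (YU c k).
Qed.

Lemma smooth_field_scale U h X : open U ->
  smooth_fun U h -> smooth_field U X -> smooth_field U (fun x => h x *: X x).
Proof.
move=> oU hU XU; apply/smooth_fieldP => // c i k.
have oc := open_chart_image (c := c) oU.
have -> : (fun x => components c x (h x *: X x) 0 i) \o psi c =
    (h \o psi c) * ((fun x => components c x (X x) 0 i) \o psi c).
  by apply/funext => u /=; rewrite componentsZ mxE.
by apply: Ck_mul (hU c k) _ => //; exact: (smooth_fieldP _ oU).1.
Qed.

Lemma smooth_field0 U : smooth_field U (fun=> 0).
Proof.
move=> c k; rewrite (_ : _ \o _ = cst 0); first exact: Ck_cst.
by apply/funext => u /=; exact: linear0.
Qed.

Lemma smooth_field_sum U (I : Type) (r : seq I) (P : pred I)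
    (X : I -> M -> 'rV[R]_n) :
  open U -> (forall i, smooth_field U (X i)) ->
  smooth_field U (fun x => \sum_(i <- r | P i) X i x).
Proof.
move=> oU XU; elim: r => [|i r IH].
  by under eq_fun do rewrite big_nil; exact: smooth_field0.
under eq_fun do rewrite big_cons; case: (P i) => //.
exact: smooth_field_add.
Qed.

Lemma smooth_coord_field c i : smooth_field (dom c) (coord_field c i).
Proof.
have oc : open (dom c) by exact: chart_dom_open.
apply: smooth_field_local => x cx; exists (dom c) => //.
apply/smooth_fieldP => // d j k.
have odc := open_chart_image (c := d) oc.
apply: (@eq_Ck _ _ _ _ _
    ((fun u => 'D_(delta_mx 0 i) (phi d \o psi c) u 0 j) \o (phi c \o psi d))) => //.
  by move=> u [y [cy dy] <-] /=; rewrite chart_funK// components_coord_field.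
apply: (@Ck_comp _ _ _ _ _ (phi c @` (dom d `&` dom c))) => //.
- by move=> u [y [cy dy] <-] /=; rewrite chart_funK//; exists y.
- apply: Ck_sub (@chart_at_smooth _ _ M d c k) => u [y [cy dy] <-].
  by exists y.
(* One order of differentiability of the transition map is spent on the partial derivative. *)
- have := (@chart_at_smooth _ _ M c d k.+1).2 (delta_mx 0 i).
  rewrite setIC => /Ck_mxP; apply.
  by apply: open_chart_image; exact: chart_dom_open.
Qed.

(** * Bilinear algebra of the metric at a point *)

Section Inner.
Variables (g : metric M) (x : M).
Implicit Types u v w : 'rV[R]_n.

Lemma innerDl u v w : g x (u + v) w = g x u w + g x v w.
Proof. by rewrite -[u]scale1r inner_linear mul1r scale1r. Qed.

Lemma inner0l w : g x 0 w = 0.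
Proof. by apply: (addrI (g x 0 w)); rewrite -innerDl !addr0. Qed.

Lemma innerZl a u w : g x (a *: u) w = a * g x u w.
Proof. by rewrite -[a *: u]addr0 inner_linear inner0l addr0. Qed.

Lemma innerDr u v w : g x w (u + v) = g x w u + g x w v.
Proof. by rewrite inner_sym innerDl; congr (_ + _); rewrite inner_sym. Qed.

Lemma innerZr a u w : g x w (a *: u) = a * g x w u.
Proof. by rewrite inner_sym innerZl inner_sym. Qed.

Lemma innerBl u v w : g x (u - v) w = g x u w - g x v w.
Proof. by rewrite innerDl -scaleN1r innerZl mulN1r. Qed.

Lemma innerBr u v w : g x w (u - v) = g x w u - g x w v.
Proof. by rewrite innerDr -scaleN1r innerZr mulN1r. Qed.

Lemma inner_suml (I : Type) (r : seq I) (P : pred I) (F : I -> 'rV[R]_n) w :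
  g x (\sum_(i <- r | P i) F i) w = \sum_(i <- r | P i) g x (F i) w.
Proof.
apply: (big_morph (fun u => g x u w)); last exact: inner0l.
by move=> u v; exact: innerDl.
Qed.

Lemma inner_sumr (I : Type) (r : seq I) (P : pred I) (F : I -> 'rV[R]_n) w :
  g x w (\sum_(i <- r | P i) F i) = \sum_(i <- r | P i) g x w (F i).
Proof. by rewrite inner_sym inner_suml; apply: eq_bigr => i _; rewrite inner_sym. Qed.

Lemma inner_eq0 u : g x u u = 0 -> u = 0.
Proof. by move=> u0; apply/eqP/negPn/negP => /(inner_pos g x); rewrite u0 ltxx. Qed.

End Inner.

(** Expanding both fields in the coordinate frame gives a double sum of products of components with
    the smooth coefficients [g_ij] of the metric. *)
Lemma smooth_inner (g : metric M) U X Y : open U ->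
  smooth_field U X -> smooth_field U Y -> smooth_fun U (fun x => g x (X x) (Y x)).
Proof.
move=> oU /(smooth_fieldP _ oU) XU /(smooth_fieldP _ oU) YU c k.
have oc := open_chart_image (c := c) oU.
pose G i j := (fun x : M => g x (coord_field c i x) (coord_field c j x)) \o psi c.
pose Z (Y : M -> 'rV[R]_n) i := (fun x : M => components c x (Y x) 0 i) \o psi c.
apply: (@eq_Ck _ _ _ _ _
  (\sum_(i < n) Z X i * \sum_(j < n) Z Y j * G i j)) => //.
  move=> _ [x [Ux cx] <-]; rewrite /comp chart_funK//.
  rewrite [in RHS](coord_field_expansion (X x) cx).
  rewrite [in RHS](coord_field_expansion (Y x) cx).
  rewrite inner_suml fct_sumE; apply: eq_bigr => i _; rewrite innerZl inner_sumr.
  rewrite -[LHS]/(Z X i (phi c x) * (\sum_(j < n) Z Y j * G i j) (phi c x)).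
  rewrite fct_sumE {1}/Z /comp chart_funK//; congr (_ * _).
  apply: eq_bigr => j _; rewrite innerZr.
  by rewrite -[LHS]/(Z Y j (phi c x) * G i j (phi c x)) /Z /G /comp chart_funK.
apply: Ck_sum => // i; apply: Ck_mul => //; first exact: XU.
apply: Ck_sum => // j; apply: Ck_mul => //; first exact: YU.
apply: Ck_sub (inner_smooth g c i j c k) => u [x [Ux cx] <-].
by exists x.
Qed.

End Charts.

(** * Global sections and orthogonal complements *)

Lemma Ck_coord (R : realType) n k (U : set 'rV[R]_n) (i : 'I_n) :
  Ck k U (fun u : 'rV[R]_n => u 0 i).
Proof.
case: k => [|k]; first by move=> u _; exact: coord_continuous.
have dc (u : 'rV[R]_n) : differentiable (fun u : 'rV[R]_n => u 0 i) u.
  exact: differentiable_coord.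
split=> // v; rewrite (_ : 'D_v _ = cst (v 0 i)); first exact: Ck_cst.
apply/funext => u; rewrite deriveE//.
have := derive_mx (@derivable_id _ _ u v); rewrite derive_id.
by move=> /matrixP/(_ 0 i); rewrite mxE deriveE.
Qed.

Lemma flat_exp_eq0 (R : realType) (t : R) : t <= 0 -> flat_exp 1 t = 0.
Proof. by rewrite /flat_exp ltNge => ->. Qed.

Lemma flat_exp_gt0 (R : realType) (t : R) : 0 < t -> 0 < flat_exp 1 t.
Proof. by move=> t0; rewrite /flat_exp t0 hornerC mul1r expR_gt0. Qed.

Section Extension.
Context (R : realType) (n : nat) (M : manifold R n).
Implicit Types (U : set M) (x y : M).

Local Notation dom c := (chart_dom (chart_at c)).
Local Notation phi c := (chart_fun (chart_at c)).
Local Notation psi c := (chart_inv (chart_at c)).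

(** [K] is the preimage of a closed cube in the chart at [x], and [b] is a product of one flat
    function per coordinate, extended by zero outside the chart domain. The closed set [K] itself,
    and not just its values, is kept so that fields cut off by [b] are seen to vanish on an open
    set. *)
Lemma bump_function U x : open U -> U x ->
  exists (b : M -> R) (K : set M),
    [/\ smooth_fun setT b, b x != 0, closed K, K `<=` U &
        forall y, ~ K y -> b y = 0].
Proof.
move=> oU Ux; have xx := @chart_at_dom _ _ M x.
pose O := phi x @` (U `&` dom x).
have /nbhs_ballP[e /= e0 eO] : nbhs (phi x x) O.
  exact: near_chart.
(* Halving the radius puts the closed cube inside the open ball. *)
pose r := e / 2; have r0 : 0 < r by rewrite divr_gt0.
pose s (i : 'I_n) (u : 'rV[R]_n) := r ^+ 2 - (u 0 i - phi x x 0 i) ^+ 2.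
pose K0 := [set u : 'rV[R]_n |
  forall i, `[phi x x 0 i - r, phi x x 0 i + r]%classic (u 0 i)].
have K0O : K0 `<=` O.
  move=> u K0u; apply: eO; split=> // i j; rewrite (ord1 i).
  have := K0u j; rewrite /= in_itv /= -ler_distl distrC => /le_lt_trans; apply.
  by rewrite /r ltr_pdivrMr// ltr_pMr// ltr1n.
pose K := psi x @` K0.
have KU : K `<=` U `&` dom x.
  by move=> _ [u /K0O [z [Uz xz] <-] <-]; rewrite chart_funK.
have cK : closed K.
  apply: (compact_closed (@manifold_hausdorff _ _ M)).
  apply: continuous_compact; last first.
    apply: (@rV_compact R n (fun i => `[phi x x 0 i - r, phi x x 0 i + r]%classic)).
    by move=> i; exact: segment_compact.
  apply: continuous_in_subspaceT => u; rewrite inE => /K0O [z [Uz xz] zu].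
  by apply: chart_inv_cont; exists z.
pose b0 (u : 'rV[R]_n) := \prod_(i < n) flat_exp 1 (s i u).
pose b y := if `[< dom x y >] then b0 (phi x y) else 0.
have b0K y : ~ K y -> b y = 0.
  move=> nK; rewrite /b; case: asboolP => // xy.
  apply: contra_notP nK => /eqP b0n; exists (phi x y); last by rewrite chart_funK.
  move=> i; rewrite /= in_itv /= -ler_distl.
  rewrite leNgt; apply: contra_neqN b0n => ri.
  rewrite /b0 (bigD1 i)//= flat_exp_eq0 ?mul0r// /s subr_le0.
  by rewrite -[leRHS]real_normK ?num_real// ler_pXn2r ?nnegrE ?(ltW r0) ?(ltW ri).
exists b, K; split => //; last by move=> y /KU[].
- apply: smooth_fun_local => y _; have [xy|nxy] := pselect (dom x y).
    exists (dom x) => //.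
    apply: (@eq_smooth_fun _ _ _ _ (fun y => b0 (phi x y))).
    + exact: chart_dom_open.
    + by move=> z xz; rewrite /b asboolT.
    + apply: smooth_fun_prod; first exact: chart_dom_open.
      move=> i; rewrite -[dom x]setTI.
      apply: (@smooth_fun_chart _ _ _ _ _ (flat_exp 1 \o s i)); first exact: openT.
      move=> k; apply: Ck_flat_exp; first by apply: open_chart_image; exact: openT.
      apply: (@Ck_sub _ _ _ _ _ setT) => //.
      pose t : 'rV[R]_n -> R := (fun u => u 0 i) + cst (- phi x x 0 i).
      have -> : s i = cst (r ^+ 2) + cst (-1) * (t * t).
        by apply/funext => u; rewrite /s /t !fctE /= mulN1r expr2.
      have Ct : Ck k setT t by apply: Ck_add; [exact: openT|exact: Ck_coord|exact: Ck_cst].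
      apply: Ck_add; [exact: openT|exact: Ck_cst|].
      apply: Ck_mul; [exact: openT|exact: Ck_cst|].
      by apply: Ck_mul; first exact: openT.
  (* A point outside the chart domain lies in the open complement of [K], where [b] is zero. *)
  exists (~` K); first by move=> /KU[].
  apply: (@eq_smooth_fun _ _ _ _ (cst 0)).
  + exact: closed_openC.
  + by move=> z /b0K ->.
  + exact: smooth_fun_cst.
- rewrite /b asboolT//; apply/prodf_neq0 => i _ /=.
  by rewrite gt_eqF// flat_exp_gt0// /s subrr expr0n subr0 exprn_gt0.
Qed.

(** The coordinates of [v] in a local frame are frozen, and the resulting local section is
    multiplied by a bump function normalised to 1 at [x]. *)
Lemma sections_extend (E : M -> {vspace 'rV[R]_n}) x v :
  smooth_distribution E -> v \in E x -> exists2 X, sections E X & X x = v.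
Proof.
case=> k /(_ x)[U [X [oU Ux sX bX]]] Ev.
have [b [K [sb bx cK KU bK]]] := bump_function oU Ux.
have XE i y : U y -> X i y \in E y.
  by move=> /bX/basis_mem; apply; apply/mapP; exists i => //; rewrite mem_enum.
pose a i := coord [tuple X i x | i < k] i v.
pose Z y := (b y / b x) *: \sum_(i < k) a i *: X i y.
have sZ : smooth_field U (fun y => \sum_(i < k) a i *: X i y).
  apply: smooth_field_sum => // i.
  by apply: (@smooth_field_scale _ _ _ _ (cst (a i))) => //; exact: smooth_fun_cst.
exists Z; last first.
  rewrite /Z divff// scale1r [RHS](coord_basis (bX x Ux) Ev).
  by apply: eq_bigr => i _; rewrite -tnth_nth tnth_mktuple.
split.
  apply: smooth_field_local => y _; have [Uy|nUy] := pselect (U y).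
    exists U => //; apply: smooth_field_scale => //.
    apply: smooth_fun_mul => //; last exact: smooth_fun_cst.
    exact: smooth_fun_sub sb.
  exists (~` K); first by move=> /KU.
  apply: (@eq_smooth_field _ _ _ _ (fun=> 0)).
  + exact: closed_openC.
  + by move=> z /bK bz; rewrite /Z bz mul0r scale0r.
  + exact: smooth_field0.
move=> y; have [Uy|nUy] := pselect (U y).
  by apply: memvZ; apply: memv_suml => i _; apply: memvZ; exact: XE.
by rewrite /Z bK ?mul0r ?scale0r ?mem0v// => /KU.
Qed.

(** * Gram matrices and orthogonal complements *)

Definition gram (g : metric M) x k (X : 'I_k -> 'rV[R]_n) : 'M[R]_k :=
  \matrix_(i, j) g x (X i) (X j).

Lemma mul_gram (g : metric M) x k (X : 'I_k -> 'rV[R]_n) (a : 'rV[R]_k) j :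
  (a *m gram g x X) 0 j = g x (\sum_(i < k) a 0 i *: X i) (X j).
Proof.
rewrite mxE inner_suml; apply: eq_bigr => i _.
by rewrite innerZl mxE.
Qed.

(** A row vector killed by the Gram matrix gives a combination orthogonal to every [X j], hence to
    itself, hence zero by positivity. *)
Lemma free_gram (g : metric M) x k (X : 'I_k -> 'rV[R]_n) :
  free [tuple X i | i < k] = (\det (gram g x X) != 0).
Proof.
rewrite -unitfE -[_ \is a _]/(gram g x X \in unitmx) -row_free_unit.
have nthX (a : 'I_k -> R) : \sum_(i < k) a i *: [tuple X i | i < k]`_i =
    \sum_(i < k) a i *: X i.
  by apply: eq_bigr => i _; rewrite -tnth_nth tnth_mktuple.
apply/idP/idP => [/freeP fX|fG].
  apply: inj_row_free => a a0; apply/rowP => i; rewrite mxE.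
  apply: (fX (fun i => a 0 i)); rewrite nthX; apply: (@inner_eq0 _ _ _ g x).
  rewrite inner_sumr big1// => j _.
  by rewrite innerZr -mul_gram a0 mxE mulr0.
apply/freeP => a; rewrite nthX => a0 i.
have : (\row_i a i) *m gram g x X = 0.
  apply/rowP => j; rewrite mul_gram mxE.
  under eq_bigr do rewrite mxE.
  by rewrite a0 inner0l.
by rewrite -(mul0mx _ (gram g x X)) => /(row_free_inj fG)/rowP/(_ i); rewrite !mxE.
Qed.

(** Encoded as the kernel of the map sending [w] to its inner products with a basis of [E], which
    makes rank-nullity available. *)
Definition orth_compl (g : metric M) x (E : {vspace 'rV[R]_n}) :
    {vspace 'rV[R]_n} :=
  lker (linfun (mulmxr (\matrix_(j < n, i < \dim E)
    g x (delta_mx 0 j) (vbasis E)`_i))).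

Lemma mem_orth_compl (g : metric M) x (E : {vspace 'rV[R]_n}) w :
  reflect (forall u, u \in E -> g x u w = 0) (w \in orth_compl g x E).
Proof.
rewrite memv_ker lfunE /=; set A := \matrix_(_, _) _.
have wA i : (w *m A) 0 i = g x w (vbasis E)`_i.
  rewrite mxE [in RHS](row_sum_delta w) inner_suml.
  by apply: eq_bigr => j _; rewrite innerZl mxE.
apply: (iffP eqP) => [w0 u Eu|w0].
  rewrite (coord_vbasis Eu) inner_suml big1// => i _.
  by rewrite innerZl inner_sym -wA w0 mxE mulr0.
apply/rowP => i; rewrite wA mxE inner_sym w0// vbasis_mem// mem_nth//.
by rewrite size_tuple.
Qed.

Lemma orth_compl_cap (g : metric M) x (E : {vspace 'rV[R]_n}) :
  (E :&: orth_compl g x E = 0)%VS.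
Proof.
apply/eqP; rewrite -subv0; apply/subvP => u; rewrite memv_cap memv0.
by move=> /andP[Eu /mem_orth_compl/(_ u Eu)/inner_eq0 ->].
Qed.

(** Rank-nullity: the complement is the kernel of a map of rank at most [\dim E], and it meets [E]
    trivially. *)
Lemma orth_compl_add (g : metric M) x (E : {vspace 'rV[R]_n}) :
  (E + orth_compl g x E = fullv)%VS.
Proof.
apply/eqP; rewrite eqEdim subvf /= dimv_disjoint_sum ?orth_compl_cap//.
rewrite -(limg_ker_dim (linfun (mulmxr (\matrix_(j < n, i < \dim E)
    g x (delta_mx 0 j) (vbasis E)`_i))) fullv) capfv addnC leq_add2r.
by rewrite (leq_trans (dimvS (subvf _)))// dimvf /dim /= mul1n.
Qed.

Lemma dim_orth_compl (g : metric M) x (E : {vspace 'rV[R]_n}) :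
  \dim (orth_compl g x E) = (n - \dim E)%N.
Proof.
have := dimv_disjoint_sum (orth_compl_cap g x E).
rewrite orth_compl_add dimvf {1}/dim /= mul1n => dimD.
have -> : \dim (orth_compl g x E) =
  (\dim E + \dim (orth_compl g x E) - \dim E)%N by rewrite addKn.
by rewrite -dimD.
Qed.

(** A basis of the complement at [x] is spread out with constant components in the chart at [x],
    then projected at each nearby point. The projections form a frame wherever their Gram
    determinant is nonzero, an open condition that holds at [x]. *)
Lemma smooth_orth_compl (g : metric M) (E : M -> {vspace 'rV[R]_n}) :
  smooth_distribution E -> smooth_distribution (fun x => orth_compl g x (E x)).
Proof.
case=> k hE; exists (n - k)%N => x; have [U [X [oU Ux sX bX]]] := hE x.
have oc : open (dom x) by exact: chart_dom_open.
pose V := U `&` dom x; have oV : open V by exact: openI.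
have xx := @chart_at_dom _ _ M x.
have sXV i : smooth_field V (X i) by apply: smooth_field_sub (sX i) => y [].
have XE i y : U y -> X i y \in E y.
  by move=> /bX/basis_mem; apply; apply/mapP; exists i => //; rewrite mem_enum.
have dimE y : U y -> \dim (E y) = k.
  by move=> /bX/size_basis.
(* The complement has dimension [n - k] at [x], so the default value of the list lookup is never
   reached. *)
pose w (i : 'I_(n - k)) := (vbasis (orth_compl g x (E x)))`_i.
pose W i y := \sum_(j < n) components x x (w i) 0 j *: coord_field x j y.
have Wx i : W i x = w i by rewrite /W -coord_field_expansion.
have sW i : smooth_field V (W i).
  apply: smooth_field_sum => // j.
  apply: (@smooth_field_scale _ _ _ _ (cst (components x x (w i) 0 j))) => //.
    exact: smooth_fun_cst.
  by apply: smooth_field_sub (@smooth_coord_field _ _ M x j) => y [].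
pose G y := gram g y (X ^~ y).
have sG i j : smooth_fun V (fun y => G y i j).
  under eq_fun do rewrite mxE.
  exact: smooth_inner.
(* det (Gram) times the orthogonal projection of W i on the complement: the
   adjugate replaces the inverse, so only sums and products occur. *)
pose Y i y := \det (G y) *: W i y +
  \sum_(a < k) \sum_(b < k) (- (g y (W i y) (X a y) * \adj (G y) a b)) *: X b y.
have sY i : smooth_field V (Y i).
  apply: smooth_field_add => //.
    by apply: smooth_field_scale => //; exact: smooth_fun_det.
  apply: smooth_field_sum => // a; apply: smooth_field_sum => // b.
  apply: smooth_field_scale => //.
  under eq_fun do rewrite -mulN1r.
  apply: smooth_fun_mul => //; first exact: smooth_fun_cst.
  by apply: smooth_fun_mul => //; [exact: smooth_inner|exact: smooth_fun_adj].
(* The adjugate times the Gram matrix is the determinant times the identity, so the correction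
   cancels the leading term. *)
have YX i y j : g y (Y i y) (X j y) = 0.
  rewrite innerDl innerZl [X in _ + X]inner_suml.
  have -> : \sum_(a < k) g y (\sum_(b < k)
      (- (g y (W i y) (X a y) * \adj (G y) a b)) *: X b y) (X j y) =
      - \sum_(a < k) g y (W i y) (X a y) * (\adj (G y) *m G y) a j.
    rewrite -sumrN; apply: eq_bigr => a _; rewrite inner_suml mxE mulr_sumr -sumrN.
    by apply: eq_bigr => b _; rewrite innerZl mulNr mulrA [G y b j]mxE.
  rewrite mul_adj_mx (bigD1 j)//= big1 => [|a /negbTE aj]; last by rewrite mxE aj mulr0.
  by rewrite mxE eqxx addr0 mulrC subrr.
have YF i y : U y -> Y i y \in orth_compl g y (E y).
  move=> Uy; apply/mem_orth_compl => u Eu.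
  rewrite (coord_basis (bX y Uy) Eu) inner_suml big1// => j _.
  by rewrite -tnth_nth tnth_mktuple innerZl inner_sym YX mulr0.
pose D y := \det (gram g y (Y ^~ y)).
have sD : smooth_fun V D.
  apply: smooth_fun_det => // i j.
  under eq_fun do rewrite mxE.
  exact: smooth_inner.
(* At [x] the vector [w i] is already orthogonal to [E x], so all correction terms vanish. *)
have Yx i : Y i x = \det (G x) *: w i.
  rewrite /Y Wx big1 ?addr0// => a _; rewrite big1// => b _.
  rewrite inner_sym; have /mem_orth_compl -> : w i \in orth_compl g x (E x).
  - by rewrite vbasis_mem// mem_nth// size_tuple dim_orth_compl dimE.
  - by rewrite mul0r oppr0 scale0r.
  - exact: XE.
have Dx : D x != 0.
  have -> : D x = \det ((\det (G x) ^+ 2) *: gram g x w).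
    congr (\det _); apply/matrixP => i j.
    by rewrite !mxE !Yx innerZl innerZr mulrA.
  rewrite detZ mulf_neq0//.
    by rewrite !expf_neq0// -(free_gram g x (X ^~ x)) (basis_free (bX x Ux)).
  rewrite -(free_gram g x w) (_ : tval _ = vbasis (orth_compl g x (E x))).
    exact: basis_free (vbasisP _).
  apply: (@eq_from_nth _ 0); rewrite ?size_tuple ?dim_orth_compl ?dimE//.
  by move=> i ink; rewrite -(tnth_nth _ _ (Ordinal ink)) tnth_mktuple.
exists (V `&` [set y | D y != 0]), Y; split => //.
- rewrite openE => y [Vy Dy]; apply: filterI; first exact: open_nbhs_nbhs.
  have cD : D z @[z --> y] --> D y := smooth_fun_continuous oV Vy sD.
  by apply: (cD [set z | z != 0]); apply: open_nbhs_nbhs; split=> //; exact: open_neq.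
- by move=> i; apply: smooth_field_sub (sY i) => y [].
- move=> y [[Uy _] Dy].
  rewrite basisEfree (free_gram g y (Y ^~ y)); apply/and3P; split=> //.
    by apply/span_subvP => _ /mapP[i _ ->]; exact: YF.
  by rewrite size_tuple dim_orth_compl dimE.
Qed.

End Extension.

(** * The tangential part of J *)

Section TangentialPart.
Context (R : realType) (p q m n : nat) (Mbar : manifold R n)
  (gbar : metric Mbar) (J : tensor11 Mbar) (M : manifold R m) (g : metric M)
  (f : M -> Mbar).
Hypotheses (hq : (0 < q)%N) (hJ : metallic gbar p q J)
  (hf : isometric_immersion g gbar f).
Implicit Types (x : M) (u v w : 'rV[R]_m) (E F : {vspace 'rV[R]_m}).

Local Notation T := (tan_part gbar J f).
Local Notation df := (differential f).
Local Notation Jdf x v := (J (f x) (df x v)).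

Lemma differentialD x u v : df x (u + v) = df x u + df x v.
Proof. exact: linearD. Qed.

Lemma differentialB x u v : df x (u - v) = df x u - df x v.
Proof. exact: linearB. Qed.

Lemma differentialZ x a v : df x (a *: v) = a *: df x v.
Proof. exact: linearZ. Qed.

Lemma differential_sum x (I : Type) (r : seq I) (P : pred I) (F : I -> 'rV[R]_m) :
  df x (\sum_(i <- r | P i) F i) = \sum_(i <- r | P i) df x (F i).
Proof. exact: linear_sum. Qed.

Lemma inner_df x u v : gbar (f x) (df x u) (df x v) = g x u v.
Proof. by have [_ _] := hf. Qed.

Lemma inner_ext x u v : (forall w, g x u w = g x v w) -> u = v.
Proof.
move=> uv; apply/eqP; rewrite -subr_eq0; apply/eqP/(@inner_eq0 _ _ _ g x).
by rewrite innerBl uv subrr.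
Qed.

(** The tangential part exists: its components solve a linear system whose matrix is the invertible
    Gram matrix of the standard basis. Hence the default value in [tan_part] never occurs. *)
Lemma inner_tan_part x v u : g x (T x v) u = gbar (f x) (Jdf x v) (df x u).
Proof.
suff : exists w, forall u,
    gbar (f x) (Jdf x v - df x w) (df x u) = 0.
  move=> /(xgetPex 0)/(_ u); rewrite -/(T x v) innerBl inner_df.
  by move/subr0_eq.
pose X (i : 'I_m) : 'rV[R]_m := delta_mx 0 i.
have uG : gram g x X \in unitmx.
  rewrite unitmxE unitfE -free_gram; apply/freeP => a a0 i.
  have : \sum_(i < m) a i *: X i = 0.
    by rewrite -[RHS]a0; apply: eq_bigr => j _; rewrite -tnth_nth tnth_mktuple.
  move=> /rowP/(_ i); rewrite summxE mxE (bigD1 i)//= big1 => [|j ji].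
    by rewrite !mxE !eqxx mulr1 addr0.
  by rewrite !mxE eq_sym (negbTE ji) andbF mulr0.
pose w : 'rV[R]_m := (\row_i gbar (f x) (Jdf x v) (df x (X i))) *m invmx (gram g x X).
exists w => {}u; rewrite innerBl inner_df; apply/eqP; rewrite subr_eq0; apply/eqP.
rewrite {1}(row_sum_delta u) differential_sum inner_sumr [in RHS](row_sum_delta u).
rewrite inner_sumr; apply: eq_bigr => i _.
rewrite differentialZ !innerZr; congr (_ * _).
transitivity ((w *m gram g x X) 0 i); first by rewrite mulmxKV// mxE.
by rewrite mul_gram /X -row_sum_delta.
Qed.

Lemma tan_part_sym x u v : g x (T x u) v = g x (T x v) u.
Proof. by rewrite !inner_tan_part hJ.2 inner_sym. Qed.

Lemma tan_partD x u v : T x (u + v) = T x u + T x v.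
Proof.
apply: (@inner_ext x) => w.
by rewrite innerDl !inner_tan_part differentialD linearD innerDl.
Qed.

Lemma tan_part0 x : T x 0 = 0.
Proof. by apply: (addrI (T x 0)); rewrite -tan_partD !addr0. Qed.

Lemma inner_Jdf x v :
  gbar (f x) (Jdf x v) (Jdf x v) = p%:R * g x (T x v) v + q%:R * g x v v.
Proof.
by rewrite -hJ.2 hJ.1 innerDl !innerZl inner_df inner_tan_part.
Qed.

(** [J] is injective: if [J] kills a vector, the metallic relation leaves [q] times that vector
    equal to 0, with [q > 0]. *)
Lemma inner_Jdf_gt0 x v : v != 0 -> 0 < gbar (f x) (Jdf x v) (Jdf x v).
Proof.
move=> v0; apply: inner_pos; apply: contra_neq v0 => Jv0.
have := hJ.1 (f x) (df x v); rewrite Jv0 scaler0 add0r linear0 => /esym/eqP.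
rewrite scaler_eq0 pnatr_eq0 -leqn0 leqNgt hq /= => /eqP dv0.
by apply: (@inner_eq0 _ _ _ g x); rewrite -inner_df dv0 inner0l.
Qed.

(** Pythagoras: the difference is the squared length of the normal part. *)
Lemma inner_tan_part_le x v :
  g x (T x v) (T x v) <= gbar (f x) (Jdf x v) (Jdf x v).
Proof.
rewrite -subr_ge0.
have -> : gbar (f x) (Jdf x v) (Jdf x v) - g x (T x v) (T x v) =
    gbar (f x) (Jdf x v - df x (T x v)) (Jdf x v - df x (T x v)).
  rewrite innerBl !innerBr inner_df -inner_tan_part (inner_sym gbar _ (df _ _)).
  by rewrite -inner_tan_part subrr subr0.
have [->|/(inner_pos gbar (f x))/ltW//] := eqVneq (Jdf x v - df x (T x v)) 0.
by rewrite inner0l.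
Qed.

(** The normal part is orthogonal to the whole image of [df x], so once [T x v] lies in [E] its
    image is the projection. *)
Lemma angle_tan_part x v E : T x v \in E ->
  angle (gbar (f x)) (Jdf x v) (df x @` [set` E]) =
  acos (Num.sqrt (g x (T x v) (T x v)) / Num.sqrt (gbar (f x) (Jdf x v) (Jdf x v))).
Proof.
move=> TE; rewrite /angle; set S := df x @` _.
suff -> : orth_proj (gbar (f x)) S (Jdf x v) = df x (T x v) by rewrite inner_df.
have PT : S (df x (T x v)) /\ forall t, S t ->
    gbar (f x) (Jdf x v - df x (T x v)) t = 0.
  split=> [|_ [u _ <-]]; first by exists (T x v).
  by rewrite innerBl inner_df inner_tan_part subrr.
(* Two candidate projections differ by a vector of [S] orthogonal to itself. *)
apply: xget_unique => // s [[w /= Ew <-] sw]; congr (df x _); apply/eqP.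
rewrite -subr_eq0; apply/eqP/(@inner_eq0 _ _ _ g x).
rewrite -inner_df; have Swv : S (df x (w - T x v)).
  by exists (w - T x v) => //=; rewrite rpredB.
have := sw _ Swv; have := PT.2 _ Swv; rewrite differentialB !innerBl => /eqP.
by rewrite subr_eq0 => /eqP <- /eqP; rewrite subr_eq0 => /eqP ->; rewrite subrr.
Qed.

(** If [b] is the [F]-component of [T x v], self-adjointness gives [g x b b = g x (T x b) v = 0]. *)
Lemma tan_part_range x v E F : (E + F)%VS = fullv ->
  (forall u w, u \in E -> w \in F -> g x u w = 0) ->
  (forall w, w \in F -> T x w = 0) -> T x v \in E.
Proof.
move=> EF ortho T0; have /memv_addP[a Ea [b Fb Tab]] : T x v \in (E + F)%VS.
  by rewrite EF memvf.
suff b0 : b = 0 by rewrite Tab b0 addr0.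
apply: (@inner_eq0 _ _ _ g x); rewrite -[LHS]add0r -(ortho a b Ea Fb) -innerDl -Tab.
by rewrite tan_part_sym T0// inner0l ortho.
Qed.

Lemma slant_tan_part2 x E theta :
  0 <= theta <= pi / 2 -> (forall v, T x v \in E) ->
  (forall v, v \in E -> v != 0 ->
    angle (gbar (f x)) (Jdf x v) (df x @` [set` E]) = theta) ->
  forall v, v \in E ->
    T x (T x v) = cos theta ^+ 2 *: (p%:R *: T x v + q%:R *: v).
Proof.
move=> th TE hang; set l := cos theta ^+ 2.
(* On the diagonal, [B v v] is the squared length of [T x v] minus [l] times that of [J v], which
   slantness makes zero on [E]. *)
pose B u v := g x (T x u) (T x v) - l * (p%:R * g x (T x u) v + q%:R * g x u v).
have Q v : v \in E -> B v v = 0.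
  move=> Ev; rewrite /B; have [->|v0] := eqVneq v 0.
    by rewrite tan_part0 !inner0l !mulr0 addr0 mulr0 subrr.
  rewrite -inner_Jdf /l -(hang v Ev v0) angle_tan_part//.
  have J0 := inner_Jdf_gt0 x v0; have TJ := inner_tan_part_le x v.
  have TT0 : 0 <= g x (T x v) (T x v).
    have [->|/(inner_pos g x)/ltW//] := eqVneq (T x v) 0.
    by rewrite inner0l.
  (* The quotient of lengths lies in [0, 1], so [cos] undoes [acos]. *)
  rewrite acosK; last first.
    rewrite in_itv /= (le_trans (lerN10 _))/= ?divr_ge0 ?sqrtr_ge0//.
    by rewrite ler_pdivrMr ?sqrtr_gt0// mul1r ler_wsqrtr.
  by rewrite expr_div_n !sqr_sqrtr ?(ltW J0)// divfK ?subrr// gt_eqF.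
(* [B] is symmetric, so polarization applies. *)
have B0 u v : u \in E -> v \in E -> B u v = 0.
  move=> Eu Ev; have := Q _ (memvD Eu Ev); have := Q _ Eu; have := Q _ Ev.
  rewrite /B !tan_partD !innerDl !innerDr (tan_part_sym x v u).
  rewrite (inner_sym g x v u) (inner_sym g x (T x v) (T x u)).
  move=> Hv Hu Huv; lra.
(* The defect [a] lies in [E] since [T] does, and [B v a = g x a a] by self-adjointness. *)
move=> v Ev; apply/eqP; rewrite -subr_eq0; set a := _ - _.
have Ea : a \in E by rewrite !(rpredB, rpredD, rpredZ)//.
apply/eqP/(@inner_eq0 _ _ _ g x); rewrite -[RHS](B0 v a Ev Ea) /B.
rewrite {1}/a innerBl innerZl innerDl !innerZl; congr (_ - _).
by rewrite tan_part_sym inner_sym.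
Qed.

(** Pairing the equation with [v] shows that the squared length of [T x v] is [l] times that of
    [J v], which is positive. *)
Lemma tan_part2_angle x E l v : 0 <= l -> (forall v, T x v \in E) ->
  T x (T x v) = l *: (p%:R *: T x v + q%:R *: v) -> v != 0 ->
  angle (gbar (f x)) (Jdf x v) (df x @` [set` E]) = acos (Num.sqrt l).
Proof.
move=> l0 TE TT v0; rewrite angle_tan_part//.
have J0 := inner_Jdf_gt0 x v0.
rewrite -tan_part_sym TT innerZl innerDl !innerZl -inner_Jdf sqrtrM//.
by rewrite mulfK// sqrtr_eq0 -ltNge.
Qed.

End TangentialPart.

(** * The range of the slant angle and the equivalence *)

Lemma smooth_distribution0 (R : realType) (m : nat) (M : manifold R m) :
  smooth_distribution (fun _ : M => 0%VS : {vspace 'rV[R]_m}).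
Proof.
exists 0%N => x; exists setT, (fun _ _ => 0); split=> // [|[]//|y _].
  exact: openT.
by rewrite tuple0; exact: nil_basis.
Qed.

(** An angle in [0, pi] beyond [pi / 2] would have negative cosine, but the cosine here is a square
    root. *)
Lemma acos_sqrt_itv (R : realType) (l : R) : 0 <= l <= 1 ->
  0 <= acos (Num.sqrt l) <= pi / 2.
Proof.
move=> /andP[l0 l1]; have s1 : -1 <= Num.sqrt l <= 1.
  rewrite (le_trans (lerN10 _)) ?sqrtr_ge0//= -[leRHS]sqrtr1.
  exact: ler_wsqrtr.
rewrite acos_ge0//= leNgt; apply/negP => lt_pi2.
have : cos (acos (Num.sqrt l)) < cos (pi / 2).
  rewrite ltr_cos// in_itv /= ?acos_ge0 ?acos_lepi//.
  by rewrite divr_ge0 ?pi_ge0//= ler_pdivrMr// ler_peMr ?pi_ge0// ler1n.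
by rewrite acosK ?in_itv// cos_pihalf ltNge sqrtr_ge0.
Qed.

Theorem proposition8 (R : realType) (p q m n : nat)
    (hp : (0 < p)%N) (hq : (0 < q)%N) (hmn : (m < n)%N)
    (Mbar : manifold R n) (gbar : metric Mbar) (J : tensor11 Mbar)
    (hJ : metallic gbar p q J)
    (M : manifold R m) (g : metric M) (f : M -> Mbar)
    (hf : isometric_immersion g gbar f) :
  hemi_slant g gbar J f <->
  exists2 lambda : R, 0 <= lambda <= 1 &
    let T := tan_part gbar J f in
    let D := [set X : M -> 'rV[R]_m | vector_field X /\
      forall x, T x (T x (X x)) = lambda *: (p%:R *: T x (X x) + q%:R *: X x)] in
    (exists2 E : M -> {vspace 'rV[R]_m}, smooth_distribution E & D = sections E) /\
    forall Y : M -> 'rV[R]_m, vector_field Y ->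
      (forall X, D X -> forall x, g x (X x) (Y x) = 0) ->
      forall x, T x (Y x) = 0.
Proof.
split.
- move=> [Dth [Dperp [[sDth sDperp] ortho full [theta th hslant] anti]]].
  have T0 x w : w \in Dperp x -> tan_part gbar J f x w = 0.
    move=> Dw; apply: (@inner_ext _ _ _ g x) => u.
    by rewrite (inner_tan_part J hf) anti// inner0l.
  have TD x v : tan_part gbar J f x v \in Dth x.
    exact: (tan_part_range hJ hf v (full x) (ortho x) (T0 x)).
  have TT x v : v \in Dth x -> tan_part gbar J f x (tan_part gbar J f x v) =
      cos theta ^+ 2 *: (p%:R *: tan_part gbar J f x v + q%:R *: v).
    by apply: (slant_tan_part2 hq hJ hf th (TD x)) => u; exact: hslant.
  exists (cos theta ^+ 2); first by rewrite sqr_ge0 -(cos2Dsin2 theta) lerDl sqr_ge0.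
  (* When [cos theta = 0], [D] consists of all vector fields, possibly more than the sections of
     [Dth]; otherwise it is exactly those sections. *)
  move=> T D; have [l0|l0] := eqVneq (cos theta ^+ 2) 0.
    have Dall X : vector_field X -> D X.
      move=> vX; split=> // x; rewrite l0 scale0r.
      (* The squared length of [T^2 X] is the inner product of [T^3 X] and [T X]; [T^3 X = 0]
         because [T X] lies in [Dth]. *)
      apply: (@inner_eq0 _ _ _ g x).
      rewrite (tan_part_sym hJ hf) (TT x _ (TD x (X x))) l0 scale0r.
      exact: inner0l.
    split; last first.
      (* [Y] itself belongs to [D], so it is orthogonal to itself. *)
      move=> Y vY /(_ Y (Dall Y vY)) YY x.
      by rewrite (inner_eq0 (YY x)); exact: (tan_part0 J hf).
    (* The whole tangent bundle, obtained as a smooth distribution by complementing 0. *)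
    exists (fun x => orth_compl g x 0%VS).
      by apply: smooth_orth_compl; exact: smooth_distribution0.
    apply/seteqP; split=> X [vX _]; last exact: Dall.
    by split=> // x; have := orth_compl_add g x 0; rewrite add0v => ->; exact: memvf.
  have DE : D = sections Dth.
    apply/seteqP; split=> X [vX XE]; split=> // x; last exact: TT.
    (* Since [T b = 0], subtracting the equation for [a] from that for [a + b] leaves
       [cos theta ^+ 2 * q] times [b] equal to 0. *)
    have /memv_addP[a Ea [b Fb Xab]] : X x \in (Dth x + Dperp x)%VS.
      by rewrite full memvf.
    suff b0 : b = 0 by rewrite Xab b0 addr0.
    have := XE x; rewrite /T Xab (tan_partD J hf) (T0 x b Fb) addr0 TT//.
    rewrite [q%:R *: (a + b)]scalerDr addrA [RHS]scalerDr -[LHS]addr0.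
    move=> /addrI/esym/eqP; rewrite scaler_eq0 => /orP[/eqP l0'|].
      by rewrite l0' eqxx in l0.
    by rewrite scaler_eq0 pnatr_eq0 -leqn0 leqNgt hq /= => /eqP.
  split; first by exists Dth.
  rewrite DE => Y vY hY x.
  (* The squared length of [T Y] is the inner product of [T^2 Y] and [Y]; extending [T^2 Y] at [x]
     to a section makes the orthogonality of [Y] to [D] applicable. *)
  have [X sX Xx] := sections_extend sDth (TD x (T x (Y x))).
  apply: (@inner_eq0 _ _ _ g x); rewrite /T (tan_part_sym hJ hf).
  by rewrite -Xx hY.
(* E x is only included in the kernel of T^2 - l (p T + q), which may be larger
   at some points. *)
- move=> [l /andP[l0 l1] [[E sE DE] hY]].
  have sF := smooth_orth_compl g sE.
  have T0 x w : w \in orth_compl g x (E x) -> tan_part gbar J f x w = 0.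
    (* The hypothesis concerns global fields, so [w] is extended to a section of the complement. *)
    move=> Fw; have [Y [vY YF] <-] := sections_extend sF Fw.
    apply: hY => // X; rewrite DE => -[_ XE] y; rewrite inner_sym.
    by have /mem_orth_compl := YF y; rewrite inner_sym; apply; exact: XE.
  have ortho x u w : u \in E x -> w \in orth_compl g x (E x) -> g x u w = 0.
    by move=> Eu /mem_orth_compl; exact.
  have TE x v : tan_part gbar J f x v \in E x.
    exact: (tan_part_range hJ hf v (orth_compl_add g x (E x)) (@ortho x) (T0 x)).
  exists E, (fun x => orth_compl g x (E x)); split=> //.
  + by move=> x; exact: orth_compl_add.
  + exists (acos (Num.sqrt l)); first by apply: acos_sqrt_itv; rewrite l0.
    move=> x v Ev v0; apply: (tan_part2_angle hq hJ hf) => //.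
    (* Extending [v] to a section of [E] turns the defining equation of [D] into one for [v]. *)
    have [X] := sections_extend sE Ev; rewrite -DE => -[_ XT] <-.
    exact: XT.
  + by move=> x v u Fv; rewrite -(inner_tan_part J hf) T0// inner0l.
Qed.
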